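(* Consider a network with $n$ nodes, excitation matrix $B$, measurement matrix $C$, edge set $E=E^0\sqcup E^\Delta$ and known part $G^0$. If the network is generically locally identifiable (i.e. locally identifiable at almost all consistent $G$), then it is generically decoupled-identifiable (i.e. decoupled-identifiable at almost all pairs $(G,G')$ of consistent network matrices).
   Context: Network. There are $n$ nodes, a set $\mathcal B$ of $n_B$ excited nodes and a set $\mathcal C$ of $n_C$ measured nodes. $B\in\{0,1\}^{n\times n_B}$ is the selection matrix of $\mathcal B$ (full column rank, each column has exactly one 1, marking an excited node); $C\in\{0,1\}^{n_C\times n}$ is the selection matrix of $\mathcal C$ (full row rank, each row has exactly one 1, marking a measured node). The network topology is a directed graph on the nodes with edge set $E$; the edge from $j$ to $i$ corresponds to the matrix entry $(i,j)$. $E$ is the disjoint union of the known edges $E^0$ and the unknown edges $E^\Delta$. A single frequency is considered, so transfer functions are complex numbers. A network matrix is $G=G^0+G^\Delta\in\mathbb C^{n\times n}$, where $G^0$ (known entries) is supported on $E^0$ and $G^\Delta$ (unknown entries) is supported on $E^\Delta$. Consistent network matrices have zero entries outside $E$ and prescribed known entries $G^0$; they are parametrized by their unknown entries in $\mathbb C^{|E^\Delta|}$. Two matrices ''have the same zero and known entries'' if both are consistent in this sense. Well-posedness is assumed throughout: only $G$ with $I-G$ invertible are considered (and such $G$ exist); $T(G)=(I-G)^{-1}$. Local identifiability. The network is locally identifiable at $G$ if there exists $\epsilon>0$ such that for every $\tilde G=G^0+\tilde G^\Delta$ with the same zero and known entries as $G$ and with $\|\tilde G-G\|<\epsilon$: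 $C\,T(\tilde G)\,B=C\,T(G)\,B\Rightarrow\tilde G^\Delta=G^\Delta$. Decoupled identifiability. For $G,G'$ sharing the same zero and known entries, the network is decoupled-identifiable at $(G,G')$ if for all $\Delta\in\mathbb C^{n\times n}$ supported on $E^\Delta$: $C\,T(G)\,\Delta\,T(G')\,B=0\Rightarrow\Delta=0$. Genericity. ''Almost all'' means all except possibly those lying on a lower-dimensional set, i.e. a set of dimension lower than that of the parameter space ($\mathbb C^{|E^\Delta|}$ for $G$, $\mathbb C^{2|E^\Delta|}$ for $(G,G')$), for instance a set contained in the zero set of a nonzero polynomial. *)

(* Defs.v *)
From mathcomp Require Import all_boot all_order all_algebra.
From mathcomp Require Import reals matrix_normedtype complex.
From mathcomp Require Import mpoly.

Set Implicit Arguments.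
Unset Strict Implicit.
Unset Printing Implicit Defensive.

Import Order.TTheory GRing.Theory Num.Theory.
Local Open Scope ring_scope.
Local Open Scope complex_scope.

(* The rows of M select the nodes of S: this is C for the measured nodes, and
   the transpose of B for the excited ones. *)
Definition selection_mx (F : fieldType) (m n : nat) (S : {set 'I_n})
    (M : 'M[F]_(m, n)) : Prop :=
  [/\ forall k i, M k i = 0 \/ M k i = 1,
      forall k, exists! i, M k i = 1,
      \rank M = m
    & forall i, i \in S <-> exists k, M k i = 1].

(* An edge is a pair (source, target), so that the edge (j, i) carries the
   entry (i, j). *)
Definition supported_on (F : fieldType) (n : nat) (E : {set 'I_n * 'I_n})
    (M : 'M[F]_n) : Prop :=
  forall i j, (j, i) \notin E -> M i j = 0.

Definition well_posed (F : fieldType) (n : nat) (G : 'M[F]_n) : Prop :=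
  1%:M - G \in unitmx.

Definition transfer (F : fieldType) (n : nat) (G : 'M[F]_n) : 'M[F]_n :=
  invmx (1%:M - G).

(* The matrix whose unknown entries are the coordinates of v, listed in the
   order of the enumeration of ED; it is zero elsewhere. *)
Definition unknown_mx (F : fieldType) (n : nat) (ED : {set 'I_n * 'I_n})
    (v : 'rV[F]_#|ED|) : 'M[F]_n :=
  \sum_(k < #|ED|) v 0 k *: delta_mx (enum_val k).2 (enum_val k).1.

(* P holds at almost all points of D: the exceptional points lie in the zero
   set of a nonzero polynomial, i.e., their Zariski closure has dimension lower
   than N.  D is the set of parameters that are considered at all. *)
Definition almost_all (F : fieldType) (N : nat) (D P : 'rV[F]_N -> Prop) :
    Prop :=
  exists2 p : {mpoly F[N]}, p != 0 &
    forall v, D v -> ~ P v -> p.@[v 0] = 0.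

(* mx_norm is the largest modulus of an entry; all norms on matrices are
   equivalent, so the choice does not affect the notion. *)
Definition locally_identifiable (R : realType) (n nB nC : nat)
    (B : 'M[R[i]]_(n, nB)) (C : 'M[R[i]]_(nC, n)) (ED : {set 'I_n * 'I_n})
    (G0 GD : 'M[R[i]]_n) : Prop :=
  exists2 eps : R, 0 < eps &
    forall GD' : 'M[R[i]]_n,
      supported_on ED GD' ->
      well_posed (G0 + GD') ->
      mx_norm ((G0 + GD') - (G0 + GD)) < eps%:C ->
      C *m transfer (G0 + GD') *m B = C *m transfer (G0 + GD) *m B ->
      GD' = GD.

Definition decoupled_identifiable (F : fieldType) (n nB nC : nat)
    (B : 'M[F]_(n, nB)) (C : 'M[F]_(nC, n)) (ED : {set 'I_n * 'I_n})
    (G G' : 'M[F]_n) : Prop :=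
  forall Delta : 'M[F]_n,
    supported_on ED Delta ->
    C *m transfer G *m Delta *m transfer G' *m B = 0 ->
    Delta = 0.

Definition generically_locally_identifiable (R : realType) (n nB nC : nat)
    (B : 'M[R[i]]_(n, nB)) (C : 'M[R[i]]_(nC, n)) (ED : {set 'I_n * 'I_n})
    (G0 : 'M[R[i]]_n) : Prop :=
  almost_all
    (fun v : 'rV_#|ED| => well_posed (G0 + unknown_mx v))
    (fun v => locally_identifiable B C ED G0 (unknown_mx v)).

Definition generically_decoupled_identifiable (F : fieldType) (n nB nC : nat)
    (B : 'M[F]_(n, nB)) (C : 'M[F]_(nC, n)) (ED : {set 'I_n * 'I_n})
    (G0 : 'M[F]_n) : Prop :=
  almost_all
    (fun w : 'rV_(#|ED| + #|ED|) =>
       well_posed (G0 + unknown_mx (lsubmx w)) /\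
       well_posed (G0 + unknown_mx (rsubmx w)))
    (fun w => decoupled_identifiable B C ED
                (G0 + unknown_mx (lsubmx w)) (G0 + unknown_mx (rsubmx w))).

(* Main.v *)
Require Import Defs.
From mathcomp Require Import all_boot all_order all_algebra.
From mathcomp Require Import reals complex ring.
From mathcomp Require Import classical_sets boolp filter topology normedtype.
From mathcomp Require Import (canonicals, coercions) mpoly.

(** Both properties are governed by the matrix of the linear map
    Delta |-> C T(G) Delta T(G') B restricted to the matrices Delta supported on
    the unknown edges. Replacing each inverse by the adjugate multiplies this
    map by nonzero determinants only and makes its matrix J(x, y) polynomial in
    the unknown entries x of G and y of G' ([response_mx]).

    If J(v, v) has full rank at one point v, one of its maximal minors is a
    polynomial in (x, y) that does not vanish at (v, v); off its zero set the
    network is decoupled-identifiable ([decoupled_of_full_rank]). So it is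
    enough to find such a point v when the network is generically locally
    identifiable ([exists_full_rank]).

    Suppose that J(x, x) is never of full rank, and let v maximize the rank of
    J(v, v) among the well-posed points outside the exceptional set. Near v
    the rank is constant, so Cramer's rule on a fixed minor yields a
    continuous field u of kernel vectors, one coordinate of which is
    constantly 1 ([kernel_row]). The output F(x) = C T(x) B is constant along
    the flow of u, and Euler's method takes the place of this flow: since
    T(x') - T(x) = T(x) (x' - x) T(x') exactly, a step from x to x + h u(x)
    changes F by h^2 times a locally bounded quantity ([output_step]). An
    Euler polygon of m steps of size a / m starting at v thus changes F by
    O(1 / m), while one coordinate moves by exactly a; a cluster point of the
    end points is a point y <> v, as close to v as desired, with F(y) = F(v)
    ([euler_polygon]). This contradicts local identifiability at v. *)

Set Implicit Arguments.
Unset Strict Implicit.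
Unset Printing Implicit Defensive.

Import Order.TTheory GRing.Theory Num.Theory.
Import numFieldNormedType.Exports.
Local Open Scope ring_scope.
Local Open Scope complex_scope.
Local Open Scope classical_set_scope.

Local Notation "'{mpoly' R [ n ] }" := (mpoly.mpoly n R)
  (format "'{mpoly'  R [ n ] }").
Local Notation "p .@[ v ]" := (mpoly.meval v p)
  (at level 1, format "p .@[ v ]").

(** * Polynomials vanishing everywhere *)

(** Distinct monomials of p contribute to distinct coefficients of the
    polynomial in the last variable. *)
Lemma muni_eq0 (n : nat) (K : nzRingType) (p : {mpoly K[n.+1]}) :
  mpoly.muni p = 0 -> p = 0.
Proof.
move=> p0; apply/mpoly.mpolyP => m0; rewrite mpoly.mcoeff0.
pose res (m : mpoly.multinom n.+1) : mpoly.multinom n :=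
  mpoly.Multinom [tuple m (widen_ord (leqnSn n) i) | i < n].
have := congr1 (fun q : {poly {mpoly K[n]}} =>
  mpoly.mcoeff (res m0) q`_(m0 ord_max)) p0.
rewrite mpoly.muniE coef0 mpoly.mcoeff0 coef_sum raddf_sum /=.
have E m : (res m == res m0) && (m ord_max == m0 ord_max) = (m == m0).
  apply/andP/eqP => [[/eqP em /eqP eM]|->] //.
  apply/mpoly.mnmP => i; case: (unliftP ord_max i) => [j|] ->; last exact: eM.
  have := congr1 (fun m' : mpoly.multinom n => m' j) em.
  rewrite !mpoly.mnmE.
  suff -> : lift ord_max j = widen_ord (leqnSn n) j by [].
  by apply/val_inj; exact: lift_max.
rewrite (eq_bigr (fun m => mpoly.mcoeff m p * (m == m0)%:R)); last first.
  move=> m _; rewrite coefZ coefXn -E -/(res m).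
  by rewrite eq_sym; case: eqP => _; rewrite ?mulr1 ?mulr0 ?mpoly.mcoeff0
    ?andbT ?andbF ?mulr0 // mpoly.mcoeffZ mpoly.mcoeffX.
move=> <-; rewrite [in LHS](mpoly.mpolyE p) raddf_sum /=.
by apply: eq_bigr => m _; rewrite mpoly.mcoeffZ mpoly.mcoeffX.
Qed.

Lemma meval_muni (n : nat) (K : comNzRingType) (p : {mpoly K[n.+1]})
    (v : 'rV[K]_n) (t : K) :
  (map_poly (mpoly.meval (v 0)) (mpoly.muni p)).[t] =
  p.@[fun i => if unlift ord_max i is Some j then v 0 j else t].
Proof.
rewrite mpoly.muniE mpoly.mevalE rmorph_sum horner_sum /=.
apply: eq_bigr => m _.
rewrite map_polyZ map_polyXn /= !mpoly.mevalZ mpoly.mevalX hornerZ hornerXn.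
rewrite -mulrA.
congr (_ * _); rewrite big_ord_recr /= unlift_none; congr (_ * _).
apply: eq_bigr => i _; rewrite mpoly.mnmE.
suff -> : widen_ord (leqnSn n) i = lift ord_max i by rewrite liftK.
by apply/val_inj; exact: esym (lift_max i).
Qed.

(** By induction on the number of variables: for fixed first variables, the
    polynomial in the last one has infinitely many roots, so each of its
    coefficients vanishes. *)
Lemma mpoly_nonroot (N : nat) (K : numFieldType) (p : {mpoly K[N]}) :
  p != 0 -> exists v : 'rV[K]_N, p.@[v 0] != 0.
Proof.
move=> /eqP p0; apply: contrapT => np; apply: p0.
have {np} : forall v : 'rV[K]_N, p.@[v 0] = 0.
  by move=> v; apply: contrapT => /eqP pv; apply: np; exists v.
elim: N p => [|N IHN] p pv.
  apply/mpoly.mpolyP => m; rewrite mpoly.mcoeff0.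
  rewrite -(pv 0) mpoly.mevalE [in LHS](mpoly.mpolyE p) raddf_sum /=.
  apply: eq_bigr => m' _.
  rewrite big_ord0 mpoly.mcoeffZ mpoly.mcoeffX.
  by rewrite (_ : m' = m) ?eqxx //; apply/mpoly.mnmP; case.
apply: muni_eq0; apply/polyP => k; rewrite coef0; apply: IHN => v.
pose pv' := map_poly (mpoly.meval (v 0)) (mpoly.muni p).
suff /polyP/(_ k) : pv' = 0.
  by rewrite coef_map coef0.
apply: contrapT => /eqP q0.
pose s := [seq j%:R : K | j <- iota 0 (size pv')].
have := max_poly_roots (rs := s) q0; rewrite size_map size_iota ltnn.
move=> roots_lt; suff : false by []; apply: roots_lt.
  apply/allP => _ /mapP[j _ ->]; apply/rootP.
  rewrite meval_muni.
  by have := pv (\row_i (if unlift ord_max i is Some j' then v 0 j' else j%:R));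
     congr (_ = _); apply: mpoly.meval_eq => i; rewrite mxE.
by rewrite map_inj_uniq ?iota_uniq // => i j /eqP; rewrite eqr_nat => /eqP.
Qed.

(** * Continuity of polynomials and compactness of complex boxes *)

Lemma big_continuous_at (T : topologicalType) (K : numFieldType) (idx : K)
    (op : Monoid.law idx) (I : Type) (r : seq I) (F : I -> T -> K) (x : T) :
  (forall f g : T -> K, {for x, continuous f} -> {for x, continuous g} ->
    {for x, continuous (fun y => op (f y) (g y))}) ->
  (forall i, {for x, continuous (F i)}) ->
  {for x, continuous (fun y => \big[op/idx]_(i <- r) F i y)}.
Proof.
move=> opc Fc; elim: r => [|i r IHr].
  rewrite (_ : (fun y => _) = (fun=> idx)); first exact: cst_continuous.
  by apply/funext => y; rewrite big_nil.
rewrite (_ : (fun y => _) =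
    (fun y => op (F i y) (\big[op/idx]_(j <- r) F j y))).
  exact: opc.
by apply/funext => y; rewrite big_cons.
Qed.

Lemma meval_continuous (N : nat) (K : numFieldType) (p : {mpoly K[N]}) :
  continuous (fun v : 'rV[K]_N => p.@[v 0]).
Proof.
move=> x.
rewrite (_ : (fun v => _) = (fun v : 'rV[K]_N =>
    \sum_(m <- mpoly.msupp p)
      mpoly.mcoeff m p * \prod_i v 0 i ^+ (m : mpoly.multinom N) i)).
  have cM (f g : 'rV[K]_N -> K) : {for x, continuous f} ->
      {for x, continuous g} -> {for x, continuous (fun y => f y * g y)}.
    by move=> fc gc; exact: continuousM.
  apply: big_continuous_at => [f g fc gc|m]; first exact: continuousD.
  apply: (cM); first exact: cst_continuous.
  apply: big_continuous_at => [|i]; first exact: (cM).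
  elim: ((m : mpoly.multinom N) i) => [|k IHk]; first exact: cst_continuous.
  rewrite (_ : (fun v => _) = (fun v : 'rV[K]_N => v 0 i * v 0 i ^+ k)).
    by apply: (cM) => //; exact: coord_continuous.
  by apply/funext => v; rewrite exprS.
by apply/funext => v; exact: mpoly.mevalE.
Qed.

(** The form of local compactness that Heine-Borel arguments use. *)
Definition bounded_in_compact (K : numFieldType) :=
  forall c : K, exists2 D : set K, compact D & [set z | `|z| <= c] `<=` D.

(** The disc lies in a square, the continuous image of a product of two real
    segments. *)
Lemma complex_bounded_in_compact (R : realType) :
  bounded_in_compact (R[i] : numFieldType).
Proof.
rewrite /bounded_in_compact; set K := (X in forall c : Num.NumField.sort X, _).
move=> c.
pose f (z : R * R) : K := z.1%:C + 'i%C * z.2%:C.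
pose S := `[- complex.Re (c : R[i]), complex.Re (c : R[i])]%classic : set R.
exists (f @` (S `*` S)); last first.
  move=> z zc.
  exists (complex.Re (z : R[i]), complex.Im (z : R[i])); last first.
    by rewrite /f /= [RHS]complexE.
  have {}zc : `|z : R[i]| <= (c : R[i]) by [].
  have := zc; rewrite normc_def lecE /= => /andP[_ zc'].
  by split; rewrite /S /= in_itv /= -ler_norml; apply: le_trans zc';
     rewrite -sqrtr_sqr ler_wsqrtr // ?lerDl ?lerDr sqr_ge0.
apply: continuous_compact; last first.
  by apply: compact_setX; exact: segment_compact.
apply: continuous_subspaceT => z.
have rc : continuous (fun x : R => x%:C : K).
  move=> x; apply/(@cvgrPdist_lt K K^o) => /= e e0.
  have : (0 : R[i]) < (e : R[i]) by [].
  rewrite ltcE /= => /andP[/eqP ime ree].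
  near=> y.
  suff : `|x%:C - y%:C| < (e : R[i]) by [].
  rewrite -rmorphB normc_def /= expr0n addr0 sqrtr_sqr ltcE /= ime eqxx /=.
  near: y; exact: (@cvgr_dist_lt _ R^o).
apply: cvgD; first by apply: cvg_comp; [exact: cvg_fst|exact: rc].
apply: cvgM; first exact: cvg_cst.
by apply: cvg_comp; [exact: cvg_snd|exact: rc].
Unshelve. all: by end_near. Qed.

(** * Euler polygons along an almost conserved quantity *)

Definition in_box (K : numFieldType) (N : nat) (r : K) (v x : 'rV[K]_N) :=
  forall j, `|x 0 j - v 0 j| <= r.

(** A neighbourhood of p on which psi stays near psi p meets every set of F,
    in particular the set where psi is near c. *)
Lemma cluster_limit (T : topologicalType) (K : numFieldType) (F : set_system T)
    (p : T) (psi : T -> K) (c : K) :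
  cluster F p -> {for p, continuous psi} ->
  (forall e, 0 < e -> F [set z | `|psi z - c| <= e]) -> psi p = c.
Proof.
move=> clp psic Fc; apply/eqP; rewrite -subr_eq0 -normr_le0.
apply: contrapT => /negP; set d := `|_|.
rewrite -real_ltNge ?normr_real ?real0 // => d0.
have e0 : 0 < d / 2 by rewrite divr_gt0.
have nb : nbhs p [set z | `|psi p - psi z| < d / 2].
  exact: (@cvgr_dist_lt _ K^o _ _ _ psi (psi p) psic).
have [z [/= z1 z2]] := clp _ _ (Fc _ e0) nb.
have : d < d by rewrite [X in _ < X](splitr d) {1}/d -(subrKA (psi z));
  apply: le_lt_trans (ler_normD _ _) _; apply: ltr_leD.
by rewrite ltxx.
Qed.

(** The end point of the polygon with m + 1 steps of size a / (m + 1) lies in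
    a fixed box, its coordinate i exceeds that of v0 by exactly a since u has
    coordinate i equal to 1, and phi has changed by at most A a^2 / (m + 1).
    These three facts pass to a cluster point of the end points. *)
Lemma euler_polygon (K : numFieldType) (N : nat) (I : Type)
    (phi : 'rV[K]_N -> I -> K) (u : 'rV[K]_N -> 'rV[K]_N) (v0 : 'rV[K]_N)
    (i : 'I_N) (r A : K) :
  bounded_in_compact K -> (forall x : K, 0 <= x -> exists n, x <= n%:R) ->
  0 < r -> 0 <= A ->
  (forall x, in_box r v0 x -> u x 0 i = 1) ->
  (forall x j, in_box r v0 x -> `|u x 0 j| <= A) ->
  (forall x j, in_box r v0 x -> {for x, continuous (phi^~ j)}) ->
  (forall x h j, 0 <= h -> in_box r v0 x -> in_box r v0 (x + h *: u x) ->
    `|phi (x + h *: u x) j - phi x j| <= A * h ^+ 2) ->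
  exists2 y, y != v0 & in_box r v0 y /\ phi y =1 phi v0.
Proof.
move=> Kc Ka r0 A0 ui uA phic phiA.
(* The polygon moves each coordinate by at most a A <= r / 2, which leaves room
   to stay in the box when passing to the limit. *)
pose a := r / (2 * (A + 1)).
have A1 : 0 < A + 1 by rewrite ltr_wpDl.
have a0 : 0 < a by rewrite divr_gt0 // mulr_gt0.
have aA : a * A <= r / 2.
  rewrite /a invfM mulrA -mulrA ler_piMr ?divr_ge0 // ?(ltW r0) //.
  by rewrite mulrC ler_pdivrMr // mul1r lerDl.
have r2 : r / 2 <= r by rewrite ler_pdivrMr // ler_peMr ?ler1n // ltW.
pose pt h l := iter l (fun x => x + h *: u x) v0.
have ptP m l : (l <= m.+1)%N -> let h := a / m.+1%:R in
    [/\ in_box (l%:R * h * A) v0 (pt h l),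
        pt h l 0 i = v0 0 i + l%:R * h
      & forall j, `|phi (pt h l) j - phi v0 j| <= l%:R * (A * h ^+ 2)].
  move=> lm h; have h0 : 0 <= h by rewrite divr_ge0 // ltW.
  have inr k x : (k <= m.+1)%N -> in_box (k%:R * h * A) v0 x ->
    in_box r v0 x.
    move=> km xk j; apply: le_trans (xk j) _; apply: le_trans r2.
    apply: le_trans aA; apply: ler_wpM2r => //.
    by rewrite /h mulrCA -[leRHS]mulr1 ler_pM2l // ler_pdivrMr // mul1r ler_nat.
  elim: l lm => [_|l IHl lm].
    by split=> [j||j]; rewrite ?mul0r ?addr0 ?subrr ?normr0.
  have [wl il pl] := IHl (ltnW lm).
  have wr := inr _ _ (ltnW lm) wl.
  have ws : in_box (l.+1%:R * h * A) v0 (pt h l.+1).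
    move=> j; rewrite /= !mxE addrAC; apply: le_trans (ler_normD _ _) _.
    rewrite -natr1 !mulrDl mul1r lerD ?wl // normrM (ger0_norm h0).
    by rewrite ler_wpM2l // uA.
  split => //= [|j].
    by rewrite !mxE il ui // mulr1 -natr1 mulrDl mul1r addrA.
  rewrite -(subrKA (phi (pt h l) j)); apply: le_trans (ler_normD _ _) _.
  rewrite -natr1 mulrDl mul1r addrC lerD //.
  by apply: phiA => //; exact: inr ws.
pose y_ (m : nat) := pt (a / m.+1%:R) m.+1.
have y_P m : [/\ in_box (r / 2) v0 (y_ m), y_ m 0 i = v0 0 i + a
  & forall j, `|phi (y_ m) j - phi v0 j| <= A * a ^+ 2 / m.+1%:R].
  have [wm im pm] := ptP m m.+1 (leqnn _).
  have m0 : m.+1%:R != 0 :> K by rewrite pnatr_eq0.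
  split=> [j||j].
  - apply: le_trans (wm j) _; rewrite (mulrCA _ a) divff // mulr1.
    exact: aA.
  - by rewrite im (mulrCA _ a) divff // mulr1.
  - apply: le_trans (pm j) _; rewrite le_eqVlt; apply/orP; left; apply/eqP.
    by field; rewrite addrC natr1.
have /choice[D DP] (j : 'I_N) : exists Dj : set K,
    compact Dj /\ forall z, `|z| <= `|v0 0 j| + r -> Dj z.
  by have [Dj Dc DP] := Kc (`|v0 0 j| + r); exists Dj.
have Fbox : (y_ @ \oo) [set x : 'rV[K]_N | forall j, D j (x 0 j)].
  exists 0%N => // m _ j; have [wm _ _] := y_P m.
  apply: (DP j).2; rewrite -(subrKC (v0 0 j) (y_ m 0 j)).
  by apply: le_trans (ler_normD _ _) _; rewrite lerD2l (le_trans (wm j)).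
have [y [_ yc]] := rV_compact (fun j => (DP j).1) _ Fbox.
have yr : in_box r v0 y.
  move=> j; have nb : nbhs y [set z : 'rV[K]_N | `|y 0 j - z 0 j| < r / 2].
    have r20 : 0 < r / 2 by rewrite divr_gt0.
    have cj := @coord_continuous K 1 N 0 j y.
    exact: (@cvgr_dist_lt _ K^o _ _ _ _ _ cj _ r20).
  have Fn : (y_ @ \oo) [set z : 'rV[K]_N | in_box (r / 2) v0 z].
    by exists 0%N => // m _; have [] := y_P m.
  have [z [/= z1 z2]] := yc _ _ Fn nb.
  rewrite [leRHS](splitr r) -(subrKA (z 0 j)).
  by apply: le_trans (ler_normD _ _) _; apply: lerD => //; exact: ltW.
exists y.
  have : y 0 i = v0 0 i + a.
    apply: (cluster_limit (psi := fun z : 'rV[K]_N => z 0 i) yc).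
      exact: coord_continuous.
    move=> e e0; exists 0%N => // m _ /=; have [_ -> _] := y_P m.
    by rewrite subrr normr0 ltW.
  apply: contra_eqN => /eqP ->.
  by rewrite -subr_eq0 opprD addrA subrr sub0r oppr_eq0 gt_eqF.
split=> // j; apply: (cluster_limit (psi := phi^~ j) yc); first exact: phic.
move=> e e0.
have [n nP] : exists n, A * a ^+ 2 / e <= n%:R.
  apply: Ka.
  exact: divr_ge0 (mulr_ge0 A0 (exprn_ge0 2 (ltW a0))) (ltW e0).
exists n => // m /= nm; have [_ _ /(_ j) pj] := y_P m; apply: le_trans pj _.
rewrite ler_pdivrMr ?ltr0Sn // [e * _]mulrC -ler_pdivrMr //.
by apply: le_trans nP _; rewrite ler_nat leqW.
Qed.

(** * Minors and kernel vectors *)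

(** Choose independent rows that span the row space, then independent columns
    of these. *)
Lemma unit_minor (F : fieldType) (m n : nat) (A : 'M[F]_(m, n)) :
  exists (g : 'I_(\rank A) -> 'I_m) (f : 'I_(\rank A) -> 'I_n),
    mxsub g f A \in unitmx.
Proof.
have full : row_full (rowsub (maxrankfun A) A)^T.
  by have := maxrowsub_free A; rewrite /row_free /row_full mxrank_tr.
exists (maxrankfun A), (fullrankfun full).
have := fullrowsub_unit full; rewrite -unitmx_tr.
by congr (_ \in unitmx); apply/matrixP => i j; rewrite !mxE.
Qed.

Lemma mxrank_mxsub (F : fieldType) (m n p q : nat) (g : 'I_p -> 'I_m)
    (f : 'I_q -> 'I_n) (A : 'M[F]_(m, n)) :
  (\rank (mxsub g f A) <= \rank A)%N.
Proof.
rewrite mxsubrc (leq_trans (mxrankS (rowsub_sub _ _))) //.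
rewrite -mxrank_tr -(mxrank_tr A) trmx_mxsub.
exact: mxrankS (rowsub_sub _ _).
Qed.

(** Unlike [invmx], which is the identity on singular matrices, this is the same
    quotient of polynomials in the entries of A at every A, so that continuity
    can be checked on it. *)
Definition ratinvmx (F : fieldType) (n : nat) (A : 'M[F]_n) : 'M[F]_n :=
  (\det A)^-1 *: \adj A.

Lemma ratinvmxE (F : fieldType) (n : nat) (A : 'M[F]_n) :
  A \in unitmx -> ratinvmx A = invmx A.
Proof. by move=> uA; rewrite /invmx uA. Qed.

(** Cramer's rule: eliminating row i of A with the rows selected by g, on the
    columns selected by f, gives a combination of rows that vanishes on these
    columns. *)
Definition kernel_row (F : fieldType) (m n r : nat) (g : 'I_r -> 'I_m)
    (f : 'I_r -> 'I_n) (i : 'I_m) (A : 'M[F]_(m, n)) : 'rV[F]_m :=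
  row i (1%:M - colsub f A *m ratinvmx (mxsub g f A) *m rowsub g 1%:M).

(** Since the rank of A is at most r, the r selected columns span the column
    space, so that a row vector killing them kills A. *)
Lemma kernel_row_mul (F : fieldType) (m n r : nat) (g : 'I_r -> 'I_m)
    (f : 'I_r -> 'I_n) (i : 'I_m) (A : 'M[F]_(m, n)) :
  mxsub g f A \in unitmx -> (\rank A <= r)%N -> kernel_row g f i A *m A = 0.
Proof.
move=> uA rA.
have sub : (A^T <= (colsub f A)^T)%MS.
  have subA : ((colsub f A)^T <= A^T)%MS by rewrite trmx_mxsub rowsub_sub.
  rewrite -(mxrank_leqif_sup subA) eqn_leq mxrankS //= !mxrank_tr.
  apply: leq_trans rA _; rewrite -{1}(mxrank_unit uA) mxsubrc.
  by apply: mxrankS; exact: rowsub_sub.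
have [X /(congr1 trmx)] := submxP sub; rewrite trmx_mul !trmxK => AX.
rewrite [X in _ *m X]AX mulmxA /kernel_row -row_mul mulmxBl mul1mx.
rewrite -!mulmxA -rowsubE -mxsubrc ratinvmxE // mulVmx // mulmx1 subrr.
by rewrite linear0 mul0mx.
Qed.

(** Row i is not among the rows used to eliminate it. *)
Lemma kernel_row1 (F : fieldType) (m n r : nat) (g : 'I_r -> 'I_m)
    (f : 'I_r -> 'I_n) (i : 'I_m) (A : 'M[F]_(m, n)) :
  (forall k, g k != i) -> kernel_row g f i A 0 i = 1.
Proof.
move=> gi; rewrite !mxE eqxx big1 ?subr0 // => k _.
by rewrite !mxE (negbTE (gi k)) mulr0.
Qed.

(** * The linear map of decoupled identifiability *)

(** [unknown_mx] over any ring, so that it can be formed over a ring of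
    polynomials. *)
Definition edge_mx (S : comNzRingType) (n : nat) (ED : {set 'I_n * 'I_n})
    (v : 'rV[S]_#|ED|) : 'M[S]_n :=
  \sum_(k < #|ED|) v 0 k *: delta_mx (enum_val k).2 (enum_val k).1.

(** The matrix I - G, called the return difference in control theory. *)
Definition return_mx (S : comNzRingType) (n : nat) (ED : {set 'I_n * 'I_n})
    (G0 : 'M[S]_n) (v : 'rV[S]_#|ED|) : 'M[S]_n :=
  1%:M - (G0 + edge_mx v).

(** Row k is the image of the k-th unknown edge under
    Delta |-> C adj(I - G) Delta adj(I - G') B. Adjugates replace the inverses so that the entries
    are polynomials in x and y. *)
Definition response_mx (S : comNzRingType) (n nB nC : nat)
    (ED : {set 'I_n * 'I_n}) (B : 'M[S]_(n, nB)) (C : 'M[S]_(nC, n))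
    (G0 : 'M[S]_n) (x y : 'rV[S]_#|ED|) : 'M[S]_(#|ED|, nC * nB) :=
  \matrix_k mxvec (C *m \adj (return_mx G0 x) *m
    delta_mx (enum_val k).2 (enum_val k).1 *m \adj (return_mx G0 y) *m B).

Lemma mul_response_mx (S : comNzRingType) (n nB nC : nat)
    (ED : {set 'I_n * 'I_n}) (B : 'M[S]_(n, nB)) (C : 'M[S]_(nC, n))
    (G0 : 'M[S]_n) (x y u : 'rV[S]_#|ED|) :
  u *m response_mx B C G0 x y =
  mxvec (C *m \adj (return_mx G0 x) *m edge_mx u *m \adj (return_mx G0 y) *m B).
Proof.
rewrite mulmx_sum_row /edge_mx mulmx_sumr !mulmx_suml linear_sum.
apply: eq_bigr => k _; rewrite rowK -linearZ; congr mxvec.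
by rewrite -scalemxAr -!scalemxAl.
Qed.

Lemma map_edge_mx (S S' : comNzRingType) (f : {rmorphism S -> S'}) (n : nat)
    (ED : {set 'I_n * 'I_n}) (v : 'rV[S]_#|ED|) :
  map_mx f (edge_mx v) = edge_mx (map_mx f v).
Proof.
rewrite /edge_mx raddf_sum; apply: eq_bigr => k _.
by rewrite /= map_mxZ map_delta_mx mxE.
Qed.

Lemma map_return_mx (S S' : comNzRingType) (f : {rmorphism S -> S'}) (n : nat)
    (ED : {set 'I_n * 'I_n}) (G0 : 'M[S]_n) (v : 'rV[S]_#|ED|) :
  map_mx f (return_mx G0 v) = return_mx (map_mx f G0) (map_mx f v).
Proof. by rewrite /return_mx map_mxB map_mx1 map_mxD map_edge_mx. Qed.

Lemma map_response_mx (S S' : comNzRingType) (f : {rmorphism S -> S'})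
    (n nB nC : nat)
    (ED : {set 'I_n * 'I_n}) (B : 'M[S]_(n, nB)) (C : 'M[S]_(nC, n))
    (G0 : 'M[S]_n) (x y : 'rV[S]_#|ED|) :
  map_mx f (response_mx B C G0 x y) =
  response_mx (map_mx f B) (map_mx f C) (map_mx f G0) (map_mx f x) (map_mx f y).
Proof.
apply/row_matrixP => k; rewrite -map_row !rowK map_mxvec.
by rewrite !map_mxM /= !map_mx_adj !map_return_mx map_delta_mx.
Qed.

Definition const_mpoly_mx (S : comNzRingType) (N m n : nat) (A : 'M[S]_(m, n)) :
    'M[{mpoly S[N]}]_(m, n) := map_mx (mpoly.mpolyC N (R := S)) A.

Lemma meval_const_mx (S : comNzRingType) (N m n : nat)
    (v : 'I_N -> S) (A : 'M[S]_(m, n)) :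
  map_mx (mpoly.meval v) (const_mpoly_mx N A) = A.
Proof. by apply/matrixP => i j; rewrite !mxE mpoly.mevalC. Qed.

Definition mpoly_vars (S : comNzRingType) (N M : nat) (h : 'I_N -> 'I_M) :
  'rV[{mpoly S[M]}]_N := \row_k mpoly.mpolyX S (mpoly.mnm1 (h k)).

Lemma meval_vars (S : comNzRingType) (N M : nat) (h : 'I_N -> 'I_M)
    (w : 'rV[S]_M) :
  map_mx (mpoly.meval (w 0)) (mpoly_vars S h) = colsub h w.
Proof. by apply/rowP => k; rewrite !mxE mpoly.mevalXU. Qed.

Lemma edge_mx_at (S : comNzRingType) (n : nat) (ED : {set 'I_n * 'I_n})
    (v : 'rV[S]_#|ED|) (k : 'I_#|ED|) :
  edge_mx v (enum_val k).2 (enum_val k).1 = v 0 k.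
Proof.
rewrite summxE (bigD1 k) //= !mxE !eqxx mulr1 big1 ?addr0 // => l lk.
rewrite !mxE -xpair_eqE; case: eqP => [[e2 e1]|_]; last by rewrite mulr0.
case/eqP: lk; apply: enum_val_inj.
by rewrite [LHS]surjective_pairing -e1 -e2 -surjective_pairing.
Qed.

Lemma edge_mx_in (S : comNzRingType) (n : nat) (ED : {set 'I_n * 'I_n})
    (v : 'rV[S]_#|ED|) (i j : 'I_n) (jiE : (j, i) \in ED) :
  edge_mx v i j = v 0 (enum_rank_in jiE (j, i)).
Proof. by rewrite -edge_mx_at enum_rankK_in. Qed.

Lemma edge_mx_out (S : comNzRingType) (n : nat) (ED : {set 'I_n * 'I_n})
    (v : 'rV[S]_#|ED|) (i j : 'I_n) :
  (j, i) \notin ED -> edge_mx v i j = 0.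
Proof.
move=> jiE; rewrite summxE big1 // => k _; rewrite !mxE.
case: eqP => [ie|_]; last by rewrite mulr0.
case: eqP => [je|_]; last by rewrite mulr0.
by move: jiE; rewrite ie je -surjective_pairing enum_valP.
Qed.

Lemma edge_mx_inj (S : comNzRingType) (n : nat) (ED : {set 'I_n * 'I_n}) :
  injective (@edge_mx S n ED).
Proof. by move=> v w vw; apply/rowP => k; rewrite -!edge_mx_at vw. Qed.

Lemma supported_edge_mx (F : fieldType) (n : nat) (ED : {set 'I_n * 'I_n})
    (D : 'M[F]_n) :
  supported_on ED D -> exists v : 'rV[F]_#|ED|, D = edge_mx v.
Proof.
move=> sD; exists (\row_k D (enum_val k).2 (enum_val k).1).
apply/matrixP => i j; have [jiE|jiE] := boolP ((j, i) \in ED).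
  by rewrite (edge_mx_in _ jiE) mxE enum_rankK_in.
by rewrite edge_mx_out // sD.
Qed.

Lemma well_posedE (F : fieldType) (n : nat) (ED : {set 'I_n * 'I_n})
    (G0 : 'M[F]_n) (v : 'rV[F]_#|ED|) :
  well_posed (G0 + edge_mx v) = (\det (return_mx G0 v) != 0).
Proof. by rewrite /well_posed unitmxE unitfE. Qed.

Lemma transferE (F : fieldType) (n : nat) (ED : {set 'I_n * 'I_n})
    (G0 : 'M[F]_n) (v : 'rV[F]_#|ED|) :
  well_posed (G0 + edge_mx v) ->
  transfer (G0 + edge_mx v) = ratinvmx (return_mx G0 v).
Proof. by move=> wv; rewrite ratinvmxE. Qed.

(** * The output along a step *)

Lemma edge_mx_add_scale (S : comNzRingType) (n : nat) (ED : {set 'I_n * 'I_n})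
    (x u : 'rV[S]_#|ED|) (h : S) :
  edge_mx (x + h *: u) = edge_mx x + h *: edge_mx u.
Proof.
rewrite /edge_mx scaler_sumr -big_split; apply: eq_bigr => k _ /=.
by rewrite !mxE scalerDl scalerA.
Qed.

Lemma invmx_sub (F : fieldType) (n : nat) (A A' : 'M[F]_n) :
  A \in unitmx -> A' \in unitmx ->
  invmx A' - invmx A = invmx A *m (A - A') *m invmx A'.
Proof.
by move=> uA uA'; rewrite mulmxBr mulmxBl mulVmx // mul1mx mulmxK.
Qed.

Definition output_mx (F : fieldType) (n nB nC : nat) (ED : {set 'I_n * 'I_n})
    (B : 'M[F]_(n, nB)) (C : 'M[F]_(nC, n)) (G0 : 'M[F]_n)
    (x : 'rV[F]_#|ED|) : 'M[F]_(nC, nB) :=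
  C *m ratinvmx (return_mx G0 x) *m B.

Lemma mul_response_mx0 (F : fieldType) (n nB nC : nat) (ED : {set 'I_n * 'I_n})
    (B : 'M[F]_(n, nB)) (C : 'M[F]_(nC, n)) (G0 : 'M[F]_n)
    (x y u : 'rV[F]_#|ED|) :
  \det (return_mx G0 x) != 0 -> \det (return_mx G0 y) != 0 ->
  (u *m response_mx B C G0 x y == 0) =
  (C *m ratinvmx (return_mx G0 x) *m edge_mx u *m
     ratinvmx (return_mx G0 y) *m B == 0).
Proof.
move=> dx dy; rewrite mul_response_mx mxvec_eq0 /ratinvmx.
rewrite -!(scalemxAr, scalemxAl) !scaler_eq0 !invr_eq0.
by rewrite (negbTE dx) (negbTE dy).
Qed.

(** Apply T(x') = T(x) + h T(x) U T(x') twice, where x' = x + h u and U is the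
    matrix of u; the term of order h is C T(x) U T(x) B, which vanishes since
    u is in the kernel of J(x, x). *)
Lemma output_step (F : fieldType) (n nB nC : nat) (ED : {set 'I_n * 'I_n})
    (B : 'M[F]_(n, nB)) (C : 'M[F]_(nC, n)) (G0 : 'M[F]_n)
    (x u : 'rV[F]_#|ED|) (h : F) :
  let T z := ratinvmx (return_mx G0 z) in
  \det (return_mx G0 x) != 0 -> \det (return_mx G0 (x + h *: u)) != 0 ->
  u *m response_mx B C G0 x x = 0 ->
  output_mx B C G0 (x + h *: u) - output_mx B C G0 x =
  h ^+ 2 *: (C *m T x *m edge_mx u *m T x *m edge_mx u *m T (x + h *: u) *m B).
Proof.
move=> T dx dx' /eqP; rewrite mul_response_mx0 // -!/(T _) => /eqP uker.
have uE z : \det (return_mx G0 z) != 0 -> return_mx G0 z \in unitmx.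
  by rewrite unitmxE unitfE.
have TE : T (x + h *: u) - T x = h *: (T x *m edge_mx u *m T (x + h *: u)).
  have dE : return_mx G0 x - return_mx G0 (x + h *: u) = h *: edge_mx u.
    rewrite /return_mx edge_mx_add_scale; move: (edge_mx x) (edge_mx u) => X U.
    by apply/matrixP => i j; rewrite !mxE; ring.
  rewrite /T !ratinvmxE ?uE // invmx_sub ?uE // dE.
  by rewrite -scalemxAr -scalemxAl.
rewrite /output_mx -!/(T _) -mulmxBl -mulmxBr TE.
have {1}-> : T (x + h *: u) = T x + h *: (T x *m edge_mx u *m T (x + h *: u)).
  by rewrite -TE subrKC.
rewrite mulmxDr scalerDr mulmxDr mulmxDl.
move: (T x) (T (x + h *: u)) uker {TE} => T1 T2 uker.
rewrite -!(scalemxAr, scalemxAl) !mulmxA uker scaler0 add0r scalerA.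
by rewrite expr2.
Qed.

(** * From full rank to decoupled identifiability *)

(** The polynomial is a maximal minor of J(x, y) with x and y independent
    variables; it is nonzero because its value at (v, v) is. *)
Lemma decoupled_of_full_rank (K : numFieldType) (n nB nC : nat)
    (ED : {set 'I_n * 'I_n}) (B : 'M[K]_(n, nB)) (C : 'M[K]_(nC, n))
    (G0 : 'M[K]_n) (v : 'rV[K]_#|ED|) :
  \rank (response_mx B C G0 v v) = #|ED| ->
  generically_decoupled_identifiable B C ED G0.
Proof.
move=> rv; have [g [f]] := unit_minor (response_mx B C G0 v v).
move: g f; rewrite rv => g f; rewrite unitmxE unitfE => gf.
pose N := #|ED|.
pose P : 'M_(#|ED|, nC * nB) := response_mx (const_mpoly_mx (N + N) B)
  (const_mpoly_mx (N + N) C) (const_mpoly_mx (N + N) G0)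
  (mpoly_vars K (@lshift N N)) (mpoly_vars K (@rshift N N)).
have PE (w : 'rV[K]_(N + N)) : (\det (mxsub g f P)).@[w 0] =
    \det (mxsub g f (response_mx B C G0 (lsubmx w) (rsubmx w))).
  rewrite -det_map_mx map_mxsub map_response_mx !meval_const_mx !meval_vars.
  by rewrite lsubmxEsub rsubmxEsub.
exists (\det (mxsub g f P)).
  apply: contra_neq gf => P0.
  by have := PE (row_mx v v); rewrite P0 mpoly.meval0 row_mxKl row_mxKr.
move=> w [wl wr] ndec; rewrite PE; apply: contra_notP ndec => /eqP gfw Delta sD.
have free : row_free (response_mx B C G0 (lsubmx w) (rsubmx w)).
  rewrite /row_free eqn_leq rank_leq_row /=.
  apply: leq_trans (mxrank_mxsub g f _).
  by rewrite mxrank_unit // unitmxE unitfE.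
have [u ->] := supported_edge_mx sD.
move: wl wr; rewrite !well_posedE => wl wr.
rewrite !transferE ?well_posedE // => /eqP; rewrite -mul_response_mx0 //.
rewrite mulmx_free_eq0 // => /eqP ->.
by rewrite /edge_mx big1 // => k _; rewrite mxE scale0r.
Qed.

(** * Continuous matrix-valued functions *)

Definition mx_continuous_at (K : numFieldType) (N m n : nat)
    (F : 'rV[K]_N -> 'M[K]_(m, n)) (x : 'rV[K]_N) :=
  forall i j, {for x, continuous (fun y => F y i j)}.

Lemma mx_continuous_meval (K : numFieldType) (N m n : nat)
    (P : 'M[{mpoly K[N]}]_(m, n)) (x : 'rV[K]_N) :
  mx_continuous_at (fun y : 'rV[K]_N => map_mx (mpoly.meval (y 0)) P) x.
Proof.
move=> i j; rewrite (_ : (fun y => _) = fun y : 'rV[K]_N => (P i j).@[y 0]).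
  exact: meval_continuous.
by apply/funext => y; rewrite mxE.
Qed.

Lemma mx_continuous_cst (K : numFieldType) (N m n : nat) (A : 'M[K]_(m, n))
    (x : 'rV[K]_N) : mx_continuous_at (fun=> A) x.
Proof. by move=> i j; exact: cst_continuous. Qed.

Lemma mx_continuous_mul (K : numFieldType) (N m n p : nat)
    (F : 'rV[K]_N -> 'M[K]_(m, n)) (G : 'rV[K]_N -> 'M[K]_(n, p)) x :
  mx_continuous_at F x -> mx_continuous_at G x ->
  mx_continuous_at (fun y => F y *m G y) x.
Proof.
move=> Fc Gc i j.
rewrite (_ : (fun y => _) = fun y => \sum_k F y i k * G y k j).
  apply: big_continuous_at => [f g fc gc|k]; first exact: continuousD.
  exact: (continuousM (Fc i k) (Gc k j)).
by apply/funext => y; rewrite mxE.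
Qed.

(** Entries of the adjugate and the determinant of a polynomial matrix are
    polynomials. *)
Lemma mx_continuous_ratinv (K : numFieldType) (N n : nat)
    (P : 'M[{mpoly K[N]}]_n) (x : 'rV[K]_N) :
  let F := fun y : 'rV[K]_N => map_mx (mpoly.meval (y 0)) P in
  \det (F x) != 0 -> mx_continuous_at (fun y => ratinvmx (F y)) x.
Proof.
move=> F Fx i j.
rewrite (_ : (fun y => _) =
  (fun y : 'rV[K]_N => ((\det P).@[y 0])^-1 * ((\adj P) i j).@[y 0])).
  apply: continuousM; last exact: meval_continuous.
  apply: continuousV; last exact: meval_continuous.
  by move: Fx; rewrite /F det_map_mx.
by apply/funext => y; rewrite [LHS]mxE /F det_map_mx -map_mx_adj [in LHS]mxE.
Qed.

Lemma near_box (K : numFieldType) (N : nat) (v : 'rV[K]_N)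
    (P : 'rV[K]_N -> Prop) :
  (\forall x \near v, P x) ->
  exists2 r, 0 < r & forall x, in_box r v x -> P x.
Proof.
move=> /nbhs_ballP[e /= e0 eP]; exists (e / 2); first by rewrite divr_gt0.
move=> x xe; apply: eP; split => // i j; rewrite (ord1 i) -ball_normE /=.
rewrite distrC; apply: le_lt_trans (xe j) _.
by rewrite ltr_pdivrMr // ltr_pMr // ltr1n.
Qed.

Lemma nbhs_meval_neq0 (K : numFieldType) (N : nat) (p : {mpoly K[N]})
    (v : 'rV[K]_N) :
  p.@[v 0] != 0 -> nbhs v [set x : 'rV[K]_N | p.@[x 0] != 0].
Proof.
move=> pv.
exact: (@cvgr_neq0 _ K^o _ _ _ _ (p.@[v 0]) (@meval_continuous N K p v)).
Qed.

Definition bounded_mx (K : numFieldType) (m n : nat) (M : K)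
    (A : 'M[K]_(m, n)) :=
  forall i j, `|A i j| <= M.

Lemma near_bounded_mx (K : numFieldType) (N m n : nat)
    (F : 'rV[K]_N -> 'M[K]_(m, n)) (x : 'rV[K]_N) :
  mx_continuous_at F x ->
  exists2 M, 0 <= M & \forall y \near x, bounded_mx M (F y).
Proof.
move=> Fc; exists (\sum_i \sum_j `|F x i j| + 1).
  by rewrite addr_ge0 // sumr_ge0 // => i _; rewrite sumr_ge0.
set M := _ + 1.
have bM i j : \forall y \near x, `|F y i j| <= M.
  have : \forall y \near x, `|F x i j - F y i j| < 1.
    exact: (@cvgr_dist_lt _ K^o _ _ _ _ _ (Fc i j) _ ltr01).
  apply: filterS => y Fy.
  rewrite -[F y i j](subKr (F x i j)); apply: le_trans (ler_normB _ _) _.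
  apply: lerD (ltW Fy); rewrite (bigD1 i) //= (bigD1 j) //= -addrA lerDl.
  by rewrite addr_ge0 // sumr_ge0 // => k _; rewrite sumr_ge0.
have bM' i : \forall y \near x, forall j, `|F y i j| <= M.
  exact: (filter_forall _ (fun j => bM i j)).
exact: (filter_forall _ bM').
Qed.

Lemma bounded_mul_mx (K : numFieldType) (m n p : nat) (M1 M2 : K)
    (A1 : 'M[K]_(m, n)) (A2 : 'M[K]_(n, p)) :
  bounded_mx M1 A1 -> bounded_mx M2 A2 ->
  bounded_mx (n%:R * (M1 * M2)) (A1 *m A2).
Proof.
move=> b1 b2 i j; rewrite mxE; apply: le_trans (ler_norm_sum _ _ _) _.
rewrite -[n in n%:R]card_ord mulr_natl -sumr_const; apply: ler_sum => k _.
by rewrite normrM ler_pM.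
Qed.

(** * From local identifiability to full rank *)

(** If the rank were never full, a point v of maximal rank off the exceptional
    set would have a continuous field of kernel vectors of J(x, x) around it,
    and Euler polygons along that field would produce points y <> v
    arbitrarily close to v with the same output. *)
Lemma exists_full_rank (K : numFieldType) (n nB nC : nat)
    (ED : {set 'I_n * 'I_n}) (B : 'M[K]_(n, nB)) (C : 'M[K]_(nC, n))
    (G0 : 'M[K]_n) (p : {mpoly K[#|ED|]}) (v1 : 'rV[K]_#|ED|) :
  bounded_in_compact K -> (forall x : K, 0 <= x -> exists m, x <= m%:R) ->
  p != 0 -> \det (return_mx G0 v1) != 0 ->
  (forall v : 'rV[K]_#|ED|, \det (return_mx G0 v) != 0 -> p.@[v 0] != 0 ->
    exists2 e, 0 < e & forall y, in_box e v y -> \det (return_mx G0 y) != 0 ->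
      output_mx B C G0 y = output_mx B C G0 v -> y = v) ->
  exists v : 'rV[K]_#|ED|, \rank (response_mx B C G0 v v) = #|ED|.
Proof.
move=> Kc Ka p0 dv1 isol; pose N := #|ED|.
pose J (x : 'rV[K]_N) := response_mx B C G0 x x.
pose vars := mpoly_vars K (@id 'I_N).
pose returnP := return_mx (const_mpoly_mx N G0) vars.
pose JP : 'M_(#|ED|, nC * nB) :=
  response_mx (const_mpoly_mx N B) (const_mpoly_mx N C) (const_mpoly_mx N G0)
    vars vars.
have varsE (x : 'rV[K]_N) : map_mx (mpoly.meval (x 0)) vars = x.
  by rewrite meval_vars; apply/rowP => k; rewrite mxE.
have returnE (x : 'rV[K]_N) :
    map_mx (mpoly.meval (x 0)) returnP = return_mx G0 x.
  by rewrite map_return_mx meval_const_mx varsE.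
have JE (x : 'rV[K]_N) : map_mx (mpoly.meval (x 0)) JP = J x.
  by rewrite map_response_mx !meval_const_mx varsE.
(* Nonzero q means well-posed and outside the exceptional set. *)
pose q := p * \det returnP.
have qE (x : 'rV[K]_N) : q.@[x 0] = p.@[x 0] * \det (return_mx G0 x).
  by rewrite mpoly.mevalM -det_map_mx returnE.
have q0 : q != 0.
  rewrite mulf_neq0 //; apply: contra_neq dv1 => d0.
  by rewrite -returnE det_map_mx d0 rmorph0.
apply: contrapT => nfull.
have Jlt x : (\rank (J x) < N)%N.
  rewrite ltn_neqAle rank_leq_row andbT; apply/eqP => rx.
  by apply: nfull; exists x.
pose attained r := `[< exists2 x : 'rV[K]_N, q.@[x 0] != 0 & \rank (J x) = r >].
have attained_ex : exists r, attained r.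
  have [x qx] := mpoly_nonroot q0.
  by exists (\rank (J x)); apply/asboolP; exists x.
have attained_le r : attained r -> (r <= N)%N.
  by move=> /asboolP[x _ <-]; exact: rank_leq_row.
case: (ex_maxnP attained_ex attained_le) => r /asboolP[v qv rv] rmax.
have {rmax} rmax (x : 'rV[K]_N) : q.@[x 0] != 0 -> (\rank (J x) <= r)%N.
  by move=> qx; apply: rmax; apply/asboolP; exists x.
have [g [f gf]] := unit_minor (J v).
move: g f gf; rewrite rv => g f gf.
(* As r is smaller than the number of rows, some row is not selected. *)
have [i gi] : exists i, forall k, g k != i.
  apply: contrapT => nex; have := Jlt v; rewrite rv ltnNge => /negP; apply.
  rewrite -[N]card_ord -[X in (_ <= X)%N]card_ord.
  apply: leq_trans (leq_image_card g 'I_r); apply: subset_leq_card.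
  apply/fintype.subsetP => i _; apply: contrapT => /negP gi; apply: nex.
  exists i => k.
  by apply: contraNneq gi => <-; exact: codom_f.
pose u x := kernel_row g f i (J x).
pose T (x : 'rV[K]_#|ED|) := ratinvmx (return_mx G0 x).
have det_q (x : 'rV[K]_N) : q.@[x 0] != 0 -> \det (return_mx G0 x) != 0.
  by rewrite qE mulf_eq0 negb_or => /andP[].
have Tc (x : 'rV[K]_N) : q.@[x 0] != 0 -> mx_continuous_at T x.
  move=> /det_q dx; rewrite (_ : T =
      fun y : 'rV[K]_N => ratinvmx (map_mx (mpoly.meval (y 0)) returnP)).
    by apply: mx_continuous_ratinv; rewrite returnE.
  by apply/funext => y; rewrite returnE.
have uc : mx_continuous_at u v.
  move=> a j.
  rewrite (_ : (fun y => _) = fun y : 'rV[K]_N => (1%:M : 'M_N) i j -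
      (map_mx (mpoly.meval (y 0)) (colsub f JP) *m
       ratinvmx (map_mx (mpoly.meval (y 0)) (mxsub g f JP)) *m
       rowsub g 1%:M) i j).
    apply: continuousB; first exact: cst_continuous.
    apply: mx_continuous_mul; last exact: mx_continuous_cst.
    apply: mx_continuous_mul; first exact: mx_continuous_meval.
    by apply: mx_continuous_ratinv; rewrite map_mxsub JE -unitfE -unitmxE.
  apply/funext => y; rewrite /u /kernel_row !map_mxsub JE [LHS]mxE [LHS]mxE.
  by congr (_ + _); rewrite [LHS]mxE.
have detJ_near : \forall x \near v, \det (mxsub g f (J x)) != 0.
  have dE (x : 'rV[K]_N) :
      (\det (mxsub g f JP)).@[x 0] = \det (mxsub g f (J x)).
    by rewrite -det_map_mx map_mxsub JE.
  have /nbhs_meval_neq0 : (\det (mxsub g f JP)).@[v 0] != 0.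
    by rewrite dE -unitfE -unitmxE.
  by apply: filterS => x; rewrite /= dE.
have q_near := nbhs_meval_neq0 qv.
have [Mu Mu0 u_near] := near_bounded_mx uc.
have [MT MT0 T_near] := near_bounded_mx (Tc v qv).
have [e e0 vP] : exists2 e, 0 < e & forall y, in_box e v y ->
    \det (return_mx G0 y) != 0 ->
    output_mx B C G0 y = output_mx B C G0 v -> y = v.
  apply: isol; first exact: det_q.
  by move: qv; rewrite qE mulf_eq0 negb_or => /andP[].
have e_near : \forall x \near v, in_box e v x.
  apply/nbhs_ballP; exists e => //= x [_ vx] j.
  by have := vx 0 j; rewrite -ball_normE /= distrC => /ltW.
have [rad rad0 good] : exists2 rad, 0 < rad & forall x, in_box rad v x ->
    [/\ q.@[x 0] != 0, \det (mxsub g f (J x)) != 0, bounded_mx Mu (u x),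
      bounded_mx MT (T x) & in_box e v x].
  apply: near_box; near=> x; split; near: x => //.
have [MC MC0 bC] : exists2 M, 0 <= M & bounded_mx M C.
  have [M M0 bM] := near_bounded_mx (@mx_continuous_cst K N _ _ C v).
  by exists M => //; exact: (nbhs_singleton bM).
have [MB MB0 bB] : exists2 M, 0 <= M & bounded_mx M B.
  have [M M0 bM] := near_bounded_mx (@mx_continuous_cst K N _ _ B v).
  by exists M => //; exact: (nbhs_singleton bM).
have bU x : in_box rad v x -> bounded_mx Mu (edge_mx (u x)).
  move=> /good[_ _ bu _ _] a b; have [abE|abE] := boolP ((b, a) \in ED).
    by rewrite (edge_mx_in _ abE); exact: bu.
  by rewrite edge_mx_out // normr0.
have uker x : in_box rad v x -> u x *m J x = 0.
  move=> /good[qx dx _ _ _]; apply: kernel_row_mul; last exact: rmax.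
  by rewrite unitmxE unitfE.
pose phi (x : 'rV[K]_N) (ab : 'I_nC * 'I_nB) := output_mx B C G0 x ab.1 ab.2.
have [y yv [yrad yphi]] : exists2 y, y != v & in_box rad v y /\ phi y =1 phi v.
  have [A A0 bA] : exists2 A, 0 <= A & forall x x', in_box rad v x ->
    in_box rad v x' -> bounded_mx A (C *m T x *m edge_mx (u x) *m T x *m
      edge_mx (u x) *m T x' *m B).
    (* The constant is read off the bounds of the seven factors. *)
    eexists; last first.
      move=> x x' xr xr'; have [_ _ _ bT _] := good _ xr.
      have [_ _ _ bT' _] := good _ xr'; have bUx := bU x xr.
      by repeat (apply: bounded_mul_mx => //); eassumption.
    by rewrite !(mulr_ge0, ler0n).
  apply: (@euler_polygon K N _ phi u v i rad (Mu + A)) => //.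
  - by rewrite addr_ge0.
  - by move=> x _; exact: kernel_row1.
  - by move=> x j /good[_ _ /(_ 0 j) bu _ _]; rewrite (le_trans bu) // lerDl.
  - move=> x [a b] /good[qx _ _ _ _].
    apply: mx_continuous_mul; last exact: mx_continuous_cst.
    by apply: mx_continuous_mul; [exact: mx_continuous_cst|exact: Tc].
  - move=> x h [a b] h0 xr xr'; have [qx _ _ _ _] := good _ xr.
    have [qx' _ _ _ _] := good _ xr'.
    have subE (X Y : 'M[K]_(nC, nB)) : X a b - Y a b = (X - Y) a b.
      by rewrite [RHS]mxE [(- Y) a b]mxE.
    rewrite /phi /= subE (output_step (det_q _ qx) (det_q _ qx') (uker _ xr)).
    rewrite [X in `|X|]mxE normrM ger0_norm ?exprn_ge0 // mulrC.
    rewrite ler_wpM2r ?exprn_ge0 // (le_trans (bA _ _ xr xr' a b)) //.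
    by rewrite lerDr.
have [qy _ _ _ ye] := good _ yrad.
case/eqP: yv; apply: (vP y ye (det_q _ qy)).
by apply/matrixP => a b; exact: (yphi (a, b)).
Unshelve. all: by end_near. Qed.

(** * Complex networks *)

Lemma mx_norm_lt (K : numDomainType) (m n : nat) (e : K) (A : 'M[K]_(m, n)) :
  0 < e -> (forall i j, `|A i j| < e) -> mx_norm A < e.
Proof.
move=> e0 Ae; have [->//|/mx_norm_neq0[ij ->]] := eqVneq (mx_norm A) 0.
exact: Ae.
Qed.

Lemma complex_nat_bound (R : realType) (x : R[i]) :
  0 <= x -> exists m, x <= m%:R.
Proof.
rewrite lecE /= => /andP[/eqP imx rex].
exists (Num.bound (complex.Re x)); rewrite lecE.
rewrite -(rmorph_nat (real_complex R)) /= imx eqxx /=.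
by apply/ltW/archi_boundP.
Qed.

Local Close Scope classical_set_scope.

Theorem mainTheorem2 (R : realType) (n nB nC : nat)
  (excited measured : {set 'I_n})
  (B : 'M[R[i]]_(n, nB)) (C : 'M[R[i]]_(nC, n))
  (E E0 ED : {set 'I_n * 'I_n}) (G0 : 'M[R[i]]_n)
  (hB : selection_mx excited B^T)
  (hC : selection_mx measured C)
  (hE : E = E0 :|: ED)
  (hdisj : [disjoint E0 & ED])
  (hG0 : supported_on E0 G0)
  (hwp : exists2 GD : 'M[R[i]]_n, supported_on ED GD & well_posed (G0 + GD)) :
  generically_locally_identifiable B C ED G0 ->
  generically_decoupled_identifiable B C ED G0.
Proof.
move=> [p p0 pP].
have [GD sGD wGD] := hwp; have [v1 GDE] := supported_edge_mx sGD.
have dv1 : \det (return_mx G0 v1) != 0 by rewrite -well_posedE -GDE.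
have [|v] := @exists_full_rank R[i] n nB nC ED B C G0 p v1
  (@complex_bounded_in_compact R) (@complex_nat_bound R) p0 dv1; last first.
  by exact: decoupled_of_full_rank.
move=> {}v dv pv.
have wv : well_posed (G0 + edge_mx v) by rewrite well_posedE.
have [eps eps0 li] : locally_identifiable B C ED G0 (unknown_mx v).
  by apply: contrapT => nli; case/eqP: pv; exact: pP.
exists (eps / 2)%:C; first by rewrite ltcR divr_gt0.
move=> y yv dy out; apply: (@edge_mx_inj R[i] n ED).
have wy : well_posed (G0 + edge_mx y) by rewrite well_posedE.
have sy : supported_on ED (edge_mx y) by move=> i j; exact: edge_mx_out.
have near_v : mx_norm ((G0 + edge_mx y) - (G0 + edge_mx v)) < eps%:C.
  apply: mx_norm_lt => [|i j]; first by rewrite ltcR.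
  have -> : (G0 + edge_mx y - (G0 + edge_mx v)) i j =
      edge_mx y i j - edge_mx v i j.
    by move: (edge_mx y) (edge_mx v) => Y V; rewrite !mxE; ring.
  have [jiE|jiE] := boolP ((j, i) \in ED); last first.
    rewrite (edge_mx_out y jiE) (edge_mx_out v jiE).
    by rewrite subr0 normr0 ltcR.
  rewrite (edge_mx_in y jiE) (edge_mx_in v jiE).
  have half : (eps / 2)%:C < eps%:C.
    rewrite ltcR ltr_pdivrMr; last by [].
    by rewrite ltr_pMr; [rewrite ltr1n|].
  exact: le_lt_trans (yv _) half.
apply: (li _ sy wy near_v).
rewrite (transferE wy).
have -> : transfer (G0 + unknown_mx v) = ratinvmx (return_mx G0 v).
  exact: transferE wv.
exact: out.
Qed.
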